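(* Let $a_0,a_\infty\in\mathbb C$, $e_t,e_1\in\mathbb C^*$, $\tilde e_1=e_te_1$. The cubic surfaces $\mathcal S_{VI}(\theta)$ and $\mathcal S_V(\tilde\theta)$ are birationally equivalent through the change of variables $X=\Phi_+(\tilde X)$, where $\Phi_+=\Phi_+(\cdot,a_0,e_t,e_1,a_\infty):\mathcal S_V(\tilde\theta)\to\mathcal S_{VI}(\theta)$ is given by $$X_0=\tilde X_1,\qquad X_t=\tfrac{\tilde X_0}{e_1}+\tfrac{\tilde X_\infty-\tilde F_{\tilde X_\infty}}{e_t},\qquad X_1=\tfrac{\tilde X_\infty}{e_1}+\tfrac{\tilde X_0}{e_t},$$ for which (on $\mathcal S_V(\tilde\theta)$) $$F_{X_0}\circ\Phi_+=\tfrac{\tilde X_0}{e_t}\Big(\tfrac{\tilde F_{\tilde X_0}}{e_1}-\tfrac{\tilde F_{\tilde X_\infty}}{e_t}\Big)-\tfrac{\tilde F_{\tilde X_1}}{e_te_1}\Big(\tilde X_1-\tfrac{e_t}{e_1}-\tfrac{e_1}{e_t}\Big),$$ $$F_{X_t}\circ\Phi_+=\tfrac{\tilde F_{\tilde X_0}}{e_1}-\tfrac{\tilde F_{\tilde X_\infty}}{e_t},\qquad F_{X_1}\circ\Phi_+=\tfrac{\tilde F_{\tilde X_0}}{e_t}+\tfrac{\tilde F_{\tilde X_\infty}}{e_1}-\tfrac{\tilde X_1\tilde F_{\tilde X_\infty}}{e_t}.$$ The inverse map $\Phi_+^{\circ(-1)}:\mathcal S_{VI}(\theta)\dashrightarrow\mathcal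 S_V(\tilde\theta)$ is given by $$\tilde X_1=X_0,\qquad \tilde X_0=-\frac{e_tX_t+e_1X_1-a_\infty-e_te_1a_0}{X_0-\frac{e_t}{e_1}-\frac{e_1}{e_t}}=-\frac{e_te_1\big(X_0-\frac{e_t}{e_1}-\frac{e_1}{e_t}-F_{X_0}\big)}{e_1X_t+e_tX_1-a_0-e_te_1a_\infty},$$ $$\tilde X_\infty=-\frac{e_1X_t+e_tX_1-a_0-e_te_1a_\infty-e_1F_{X_t}}{X_0-\frac{e_t}{e_1}-\frac{e_1}{e_t}},$$ and is singular on the line $$L_0=\Big\{X_0=\tfrac{e_t}{e_1}+\tfrac{e_1}{e_t},\ \ e_1X_t+e_tX_1=\tilde\theta_0\Big\}.$$ The two Fricke polynomials are related by $$F\circ\Phi_+=\tfrac{-1}{e_te_1}\Big(X_0-\tfrac{e_t}{e_1}-\tfrac{e_1}{e_t}\Big)\cdot\tilde F\qquad(X_0=\tilde X_1).$$ The restriction $\Phi_+:\mathcal S_V(\tilde\theta)\to\mathcal S_{VI}(\theta)\smallsetminus L_0$ is an isomorphism. The pull-back by $\Phi_+$ of the symplectic form $\omega_{\mathcal S_{VI}}$ is the symplectic form $\tilde\omega_{\mathcal S_V}$.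
   Context: **Character variety of $P_{VI}$.** Put $a_t=e_t+e_t^{-1}$, $a_1=e_1+e_1^{-1}$. For coordinates $X=(X_0,X_t,X_1)\in\mathbb C^3$, $F(X,\theta)=X_0X_tX_1+X_0^2+X_t^2+X_1^2-\theta_0X_0-\theta_tX_t-\theta_1X_1+\theta_\infty$, with $\theta_i=a_ia_\infty+a_ja_k$ for $\{i,j,k\}=\{0,t,1\}$ and $\theta_\infty=a_0a_ta_1a_\infty+a_0^2+a_t^2+a_1^2+a_\infty^2-4$. $\mathcal S_{VI}(\theta)=\{F=0\}\subset\mathbb C^3$; $F_{X_i}=\partial F/\partial X_i=X_jX_k+2X_i-\theta_i$; $\omega_{\mathcal S_{VI}}=\frac{dX_t\wedge dX_0}{2\pi iF_{X_1}}=\frac{dX_1\wedge dX_t}{2\pi iF_{X_0}}=\frac{dX_0\wedge dX_1}{2\pi iF_{X_t}}$. **Wild character variety of $P_V$.** For $\tilde X=(\tilde X_0,\tilde X_1,\tilde X_\infty)\in\mathbb C^3$, $\tilde F(\tilde X,\tilde\theta)=\tilde X_0\tilde X_1\tilde X_\infty+\tilde X_0^2+\tilde X_\infty^2-\tilde\theta_0\tilde X_0-\tilde\theta_1\tilde X_1-\tilde\theta_\infty\tilde X_\infty+\tilde\theta_t$, with $\tilde\theta_0=a_0+\tilde e_1a_\infty$, $\tilde\theta_1=\tilde e_1$, $\tilde\theta_\infty=a_\infty+\tilde e_1a_0$, $\tilde\theta_t=1+\tilde e_1a_0a_\infty+\tilde e_1^2$. $\mathcal S_V(\tilde\theta)=\{\tilde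 F=0\}\subset\mathbb C^3$; $\tilde F_{\tilde X_0}=\tilde X_1\tilde X_\infty+2\tilde X_0-\tilde\theta_0$, $\tilde F_{\tilde X_1}=\tilde X_\infty\tilde X_0-\tilde\theta_1$, $\tilde F_{\tilde X_\infty}=\tilde X_1\tilde X_0+2\tilde X_\infty-\tilde\theta_\infty$; $\tilde\omega_{\mathcal S_V}=\frac{d\tilde X_0\wedge d\tilde X_1}{2\pi i\tilde F_{\tilde X_\infty}}=\frac{d\tilde X_\infty\wedge d\tilde X_0}{2\pi i\tilde F_{\tilde X_1}}=\frac{d\tilde X_1\wedge d\tilde X_\infty}{2\pi i\tilde F_{\tilde X_0}}$. (In the paper the parameters arise for $\epsilon\neq0$ as $a_0=2\cos\pi\vartheta_0$, $a_\infty=2\cos\pi\vartheta_\infty$, $e_t=e^{\pi i/\epsilon}$, $e_1=e^{\pi i\tilde\vartheta_1-\pi i/\epsilon}$, $\tilde e_1=e^{\pi i\tilde\vartheta_1}$.)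
   Formalization: The isomorphism S_V → S_VI∖L_0 fails if S_VI has a singular point on L_0 (e.g. e_t=1, e_1=2, a_0=a_∞=0); it is stated on S_V∖Φ_+^{-1}(L_0) always, and on all S_V if S_VI is smooth along L_0; the pull-back is compared at smooth points with smooth image. *)

(* Defs.v *)
From HB Require Import structures.
From mathcomp Require Import all_boot all_order all_algebra.
From mathcomp Require Import mpoly complex ring.
From mathcomp Require Import classical_sets reals trigo.
Set Implicit Arguments.
Unset Strict Implicit.
Unset Printing Implicit Defensive.
Import GRing.Theory Num.Theory.
Local Open Scope ring_scope.
Local Open Scope classical_set_scope.

(* Affine n-space over K is 'rV[K]_n with its Zariski topology. *)

Definition mev (K : fieldType) n (p : {mpoly K[n]}) (x : 'rV[K]_n) : K :=
  p.@[x 0].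

Definition zero_locus (K : fieldType) n (J : set {mpoly K[n]}) : set 'rV[K]_n :=
  [set x | forall p, J p -> mev p x = 0].

Definition hypersurface (K : fieldType) n (F : {mpoly K[n]}) : set 'rV[K]_n :=
  [set x | mev F x = 0].

Definition zopen_in (K : fieldType) n (S U : set 'rV[K]_n) : Prop :=
  exists J : set {mpoly K[n]}, U = S `\` zero_locus J.

Definition zdense_in (K : fieldType) n (S U : set 'rV[K]_n) : Prop :=
  U `<=` S /\
  forall J : set {mpoly K[n]}, U `<=` zero_locus J -> S `<=` zero_locus J.

(* The basic open set B <> 0 may serve as the neighbourhood on which f = A / B:
   if f = A / B only where h <> 0, replace (A, B) by (A h, B h). *)
Definition regular_on (K : fieldType) n (S : set 'rV[K]_n) (f : 'rV[K]_n -> K)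
    : Prop :=
  forall x, S x -> exists A B : {mpoly K[n]}, mev B x != 0 /\
    forall y, S y -> mev B y != 0 -> f y = mev A y / mev B y.

(* Here and below, f is only looked at on S; its values elsewhere are junk. *)
Definition morphism_on (K : fieldType) m n (S : set 'rV[K]_m)
    (T : set 'rV[K]_n) (f : 'rV[K]_m -> 'rV[K]_n) : Prop :=
  (forall x, S x -> T (f x)) /\ forall i, regular_on S (fun x => f x 0 i).

Definition isomorphism_on (K : fieldType) m n (S : set 'rV[K]_m)
    (T : set 'rV[K]_n) (f : 'rV[K]_m -> 'rV[K]_n) : Prop :=
  morphism_on S T f /\
  exists g : 'rV[K]_n -> 'rV[K]_m,
    [/\ morphism_on T S g,
        forall x, S x -> g (f x) = x &
        forall y, T y -> f (g y) = y].

Definition birational_on (K : fieldType) m n (S : set 'rV[K]_m)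
    (T : set 'rV[K]_n) (f : 'rV[K]_m -> 'rV[K]_n) : Prop :=
  exists U V,
    [/\ zopen_in S U /\ zdense_in S U, zopen_in T V /\ zdense_in T V &
        isomorphism_on U V f].

(* (D, f) represents a rational map from S to T. *)
Definition rational_map (K : fieldType) m n (S : set 'rV[K]_m)
    (T : set 'rV[K]_n) (D : set 'rV[K]_m) (f : 'rV[K]_m -> 'rV[K]_n) : Prop :=
  [/\ zopen_in S D, zdense_in S D & morphism_on D T f].

(* x lies in the domain of definition of the rational map represented by
   (D, f); the points of S where this fails are its singular
   (indeterminacy) points. *)
Definition defined_at (K : fieldType) m n (S : set 'rV[K]_m)
    (T : set 'rV[K]_n) (D : set 'rV[K]_m) (f : 'rV[K]_m -> 'rV[K]_n)
    (x : 'rV[K]_m) : Prop :=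
  exists (U : set 'rV[K]_m) (g : 'rV[K]_m -> 'rV[K]_n),
    [/\ zopen_in S U, U x, morphism_on U T g &
        forall y, U y -> D y -> g y = f y].

Definition polymap (K : fieldType) m n (q : n.-tuple {mpoly K[m]})
    (x : 'rV[K]_m) : 'rV[K]_n :=
  \row_i mev (tnth q i) x.

Definition dpolymap (K : fieldType) m n (q : n.-tuple {mpoly K[m]})
    (x v : 'rV[K]_m) : 'rV[K]_n :=
  \row_i \sum_j mev (tnth q i)^`M(j) x * v 0 j.

Definition smooth_at (K : fieldType) n (F : {mpoly K[n]}) (x : 'rV[K]_n)
    : Prop :=
  exists i, mev F^`M(i) x != 0.

Definition tangent_at (K : fieldType) n (F : {mpoly K[n]}) (x v : 'rV[K]_n)
    : Prop :=
  \sum_i mev F^`M(i) x * v 0 i = 0.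

(* dx_i /\ dx_j *)
Definition wedge (K : fieldType) n (i j : 'I_n) (u v : 'rV[K]_n) : K :=
  u 0 i * v 0 j - u 0 j * v 0 i.

(* The 2-form dx_i /\ dx_j / (c F_k) = dx_k /\ dx_i / (c F_j)
   = dx_j /\ dx_k / (c F_i) at a smooth point x of F = 0, as a bilinear form on
   tangent vectors; residue_formE says that the choice among the formulas
   with nonzero denominator does not matter. *)
Definition residue_form (K : fieldType) (c : K) (F : {mpoly K[3]})
    (i j k : 'I_3) (x u v : 'rV[K]_3) : K :=
  if mev F^`M(k) x != 0 then wedge i j u v / (c * mev F^`M(k) x)
  else if mev F^`M(j) x != 0 then wedge k i u v / (c * mev F^`M(j) x)
  else wedge j k u v / (c * mev F^`M(i) x).

Lemma residue_formE (K : fieldType) (c : K) (F : {mpoly K[3]})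
    (i j k : 'I_3) (x u v : 'rV[K]_3) :
  uniq [:: i; j; k] -> tangent_at F x u -> tangent_at F x v ->
  [/\ mev F^`M(k) x != 0 ->
        residue_form c F i j k x u v = wedge i j u v / (c * mev F^`M(k) x),
      mev F^`M(j) x != 0 ->
        residue_form c F i j k x u v = wedge k i u v / (c * mev F^`M(j) x) &
      mev F^`M(i) x != 0 ->
        residue_form c F i j k x u v = wedge j k u v / (c * mev F^`M(i) x)].
Proof.
move=> Uijk; rewrite /tangent_at.
have sum3 (G : 'I_3 -> K) : \sum_l G l = G i + G j + G k.
  have enum3 : perm_eq (index_enum 'I_3) [:: i; j; k].
    apply: uniq_perm => //; first exact: index_enum_uniq.
    have card3 : #|[:: i; j; k]| = #|'I_3| by rewrite (card_uniqP Uijk) card_ord.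
    move=> l; rewrite mem_index_enum; symmetry.
    by have /subset_cardP/(_ (subset_predT _)) -> := card3.
  by rewrite (perm_big _ enum3) /= !big_cons big_nil /= addr0 addrA.
rewrite !sum3 /residue_form /wedge.
move: (mev F^`M(i) x) (mev F^`M(j) x) (mev F^`M(k) x) => Fi Fj Fk.
move: (u 0 i) (u 0 j) (u 0 k) (v 0 i) (v 0 j) (v 0 k).
move=> ui uj uk vi vj vk Tu Tv.
have quot a b p q : p != 0 -> q != 0 -> a * q = b * p ->
    a / (c * p) = b / (c * q).
  move=> p0 q0 abpq; rewrite !invfM mulrCA [RHS]mulrCA; congr (_ * _).
  by apply/eqP; rewrite eqr_div// abpq.
have jk : (ui * vj - uj * vi) * Fj = (uk * vi - ui * vk) * Fk.
  apply/eqP; rewrite -subr_eq0; apply/eqP.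
  transitivity (ui * (Fi * vi + Fj * vj + Fk * vk)
                - vi * (Fi * ui + Fj * uj + Fk * uk)); first by ring.
  by rewrite Tu Tv !mulr0 subr0.
have ik : (ui * vj - uj * vi) * Fi = (uj * vk - uk * vj) * Fk.
  apply/eqP; rewrite -subr_eq0; apply/eqP.
  transitivity (vj * (Fi * ui + Fj * uj + Fk * uk)
                - uj * (Fi * vi + Fj * vj + Fk * vk)); first by ring.
  by rewrite Tu Tv !mulr0 subr0.
have ij : (uk * vi - ui * vk) * Fi = (uj * vk - uk * vj) * Fj.
  apply/eqP; rewrite -subr_eq0; apply/eqP.
  transitivity (uk * (Fi * vi + Fj * vj + Fk * vk)
                - vk * (Fi * ui + Fj * uj + Fk * uk)); first by ring.
  by rewrite Tu Tv !mulr0 subr0.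
split=> nz; first by rewrite nz.
  by case: ifP => k0 //; rewrite ?nz //; apply: quot.
by case: ifP => k0; [apply: quot | case: ifP => j0 //; apply: quot].
Qed.

Definition pullback (K : fieldType) m n (q : n.-tuple {mpoly K[m]})
    (omega : 'rV[K]_n -> 'rV[K]_n -> 'rV[K]_n -> K)
    (x u v : 'rV[K]_m) : K :=
  omega (polymap q x) (dpolymap q x u) (dpolymap q x v).

Definition twopii (R : realType) : R[i] := Complex 0 (pi *+ 2).

(* Positions of the coordinates X = (X_0, X_t, X_1) on the P_VI side and
   X = (X_0, X_1, X_oo) on the P_V side. *)
Definition vi_0 : 'I_3 := @Ordinal 3 0 isT.
Definition vi_t : 'I_3 := @Ordinal 3 1 isT.
Definition vi_1 : 'I_3 := @Ordinal 3 2 isT.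

Definition v_0 : 'I_3 := @Ordinal 3 0 isT.
Definition v_1 : 'I_3 := @Ordinal 3 1 isT.
Definition v_oo : 'I_3 := @Ordinal 3 2 isT.

Definition FVI (K : fieldType) (a0 et e1 aoo : K) : {mpoly K[3]} :=
  let a_t := et + et^-1 in
  let a_1 := e1 + e1^-1 in
  let theta0 := a0 * aoo + a_t * a_1 in
  let thetat := a_t * aoo + a0 * a_1 in
  let theta1 := a_1 * aoo + a0 * a_t in
  let thetaoo := a0 * a_t * a_1 * aoo + a0 ^+ 2 + a_t ^+ 2 + a_1 ^+ 2
                 + aoo ^+ 2 - 4%:R in
  'X_vi_0 * 'X_vi_t * 'X_vi_1 + 'X_vi_0 ^+ 2 + 'X_vi_t ^+ 2 + 'X_vi_1 ^+ 2
  - theta0 *: 'X_vi_0 - thetat *: 'X_vi_t - theta1 *: 'X_vi_1 + thetaoo%:MP.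

Definition FV (K : fieldType) (a0 te1 aoo : K) : {mpoly K[3]} :=
  let theta0 := a0 + te1 * aoo in
  let theta1 := te1 in
  let thetaoo := aoo + te1 * a0 in
  let thetat := 1 + te1 * a0 * aoo + te1 ^+ 2 in
  'X_v_0 * 'X_v_1 * 'X_v_oo + 'X_v_0 ^+ 2 + 'X_v_oo ^+ 2
  - theta0 *: 'X_v_0 - theta1 *: 'X_v_1 - thetaoo *: 'X_v_oo + thetat%:MP.

Definition omegaVI (R : realType) (a0 et e1 aoo : R[i]) :=
  residue_form (twopii R) (FVI a0 et e1 aoo) vi_t vi_0 vi_1.

Definition omegaV (R : realType) (a0 te1 aoo : R[i]) :=
  residue_form (twopii R) (FV a0 te1 aoo) v_0 v_1 v_oo.

Definition Phi_plus (K : fieldType) (a0 et e1 aoo : K) :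
    3.-tuple {mpoly K[3]} :=
  let F := FV a0 (et * e1) aoo in
  [tuple 'X_v_1;
         e1^-1 *: 'X_v_0 + et^-1 *: ('X_v_oo - F^`M(v_oo));
         e1^-1 *: 'X_v_oo + et^-1 *: 'X_v_0].

(* The two denominators in the formulas for the inverse of Phi_plus. *)
Definition den1 (K : fieldType) (et e1 : K) (X : 'rV[K]_3) : K :=
  X 0 vi_0 - et / e1 - e1 / et.

Definition den2 (K : fieldType) (a0 et e1 aoo : K) (X : 'rV[K]_3) : K :=
  e1 * X 0 vi_t + et * X 0 vi_1 - a0 - et * e1 * aoo.

Definition Psi_0 (K : fieldType) (a0 et e1 aoo : K) (X : 'rV[K]_3) : K :=
  - ((et * X 0 vi_t + e1 * X 0 vi_1 - aoo - et * e1 * a0) / den1 et e1 X).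

Definition Psi_0' (K : fieldType) (a0 et e1 aoo : K) (X : 'rV[K]_3) : K :=
  - (et * e1 * (X 0 vi_0 - et / e1 - e1 / et
                - mev (FVI a0 et e1 aoo)^`M(vi_0) X)
     / den2 a0 et e1 aoo X).

Definition Psi_oo (K : fieldType) (a0 et e1 aoo : K) (X : 'rV[K]_3) : K :=
  - ((e1 * X 0 vi_t + et * X 0 vi_1 - a0 - et * e1 * aoo
      - e1 * mev (FVI a0 et e1 aoo)^`M(vi_t) X) / den1 et e1 X).

Definition Psi (K : fieldType) (a0 et e1 aoo : K) (X : 'rV[K]_3) :
    'rV[K]_3 :=
  \row_i tnth [tuple Psi_0 a0 et e1 aoo X; X 0 vi_0; Psi_oo a0 et e1 aoo X] i.

Definition L0 (K : fieldType) (a0 et e1 aoo : K) : set 'rV[K]_3 :=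
  [set X | X 0 vi_0 = et / e1 + e1 / et /\
           e1 * X 0 vi_t + et * X 0 vi_1 = a0 + et * e1 * aoo].

(* Main.v *)
Require Import Defs.
From HB Require Import structures.
From mathcomp Require Import all_boot all_order all_algebra.
From mathcomp Require Import mpoly complex ring.
From mathcomp Require Import boolp classical_sets reals trigo.
Set Implicit Arguments.
Unset Strict Implicit.
Unset Printing Implicit Defensive.
Import GRing.Theory Pdiv.Ring Pdiv.RingMonic.
Local Open Scope ring_scope.
Local Open Scope classical_set_scope.

(* Put d1 = X_0 - et/e1 - e1/et, and let m, d2 be the linear forms
   et X_t + e1 X_1 - ..., e1 X_t + et X_1 - ... of the two expressions of the
   first coordinate of the inverse. The formula et e1 F = m d2 - et e1 d1
   (d1 - F_{X_0}) shows that these expressions, - m / d1 and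
   - et e1 (d1 - F_{X_0}) / d2, agree on F = 0, so the inverse is regular off
   L = {d1 = d2 = 0}. If it were regular at a point of L, then m d2 = et e1 d1
   (d1 - F_{X_0}) divided by d1 would give F_{X_0} = 0 at all nearby points of
   L, but F_{X_0} is a nonconstant quadratic polynomial on L. If Phi x is on L
   then grad F vanishes at Phi x, by the formulas for the partial derivatives.
   Those formulas also say that the cofactor matrix of dPhi maps grad tF to
   grad F, which is the compatibility of the two residue forms.
   The complement of d1 = 0 is dense since both surfaces are monic quadratic in
   some coordinate other than the one that appears in d1. *)

(** * Derivatives of variables and restriction to parametrized planes *)

Lemma mderivXU (R : nzRingType) n (i j : 'I_n) :
  ('X_j : {mpoly R[n]})^`M(i) = ((i == j)%:R)%:MP.
Proof.
rewrite mderivX mnm1E eq_sym; have [->|_] := eqVneq i j; last first.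
  by rewrite scale0r mpolyC0.
rewrite scale1r (_ : _ - _ = 0)%MM ?mpolyX0 ?mpolyC1//.
by apply/mnmP => k; rewrite mnmBE subnn mnm0E.
Qed.

(** Restricts [p] to a surface parametrized by [h]: the outer variable takes the value [y], the
    inner one the value [s]. *)
Lemma horner2_mmap (R : comNzRingType) n (h : 'I_n -> {poly {poly R}})
    (p : {mpoly R[n]}) (s y : R) :
  (mmap (polyC \o polyC) h p).[y%:P].[s] = p.@[fun i => (h i).[y%:P].[s]].
Proof.
rewrite mevalE /mmap !horner_sum; apply: eq_bigr => m _.
rewrite !hornerCM /mmap1 -!horner_evalE !rmorph_prod /=; congr (_ * _).
by apply: eq_bigr => i _; rewrite !horner_evalE !hornerE.
Qed.

(* In the shape in which Fricke_Phi_plus meets it, with squares expanded, and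
   over an abstract field: field does not cope with the fraction field of
   {mpoly K[3]}. *)
Lemma Fricke_identity (L : fieldType) (a0 e d aoo x0 x1 xoo : L)
    (xt := d^-1 * x0
           + e^-1 * (xoo - (x0 * x1 + (xoo + xoo) - (aoo + e * d * a0))))
    (y1 := d^-1 * xoo + e^-1 * x0)
    (at_ := e + e^-1) (a1 := d + d^-1) :
  e != 0 -> d != 0 ->
  x1 * xt * y1 + x1 * x1 + xt * xt + y1 * y1
  - (a0 * aoo + at_ * a1) * x1 - (at_ * aoo + a0 * a1) * xt
  - (a1 * aoo + a0 * at_) * y1
  + (a0 * at_ * a1 * aoo + a0 * a0 + at_ * at_ + a1 * a1 + aoo * aoo
     - (1 + (1 + (1 + 1)))) =
  - 1 / (e * d) *
  ((x1 - (e / d + d / e)) *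
   (x0 * x1 * xoo + x0 * x0 + xoo * xoo - (a0 + e * d * aoo) * x0
    - e * d * x1 - (aoo + e * d * a0) * xoo
    + (1 + e * d * a0 * aoo + e * d * (e * d)))).
Proof.
move=> e0 d0; rewrite /xt /y1 /at_ /a1; field.
by rewrite e0 d0.
Qed.

(** * Explicit formulas for the two cubics, for Phi and for its differential *)

Section EvalFV.
Context (K : fieldType).
Implicit Types (x X : 'rV[K]_3).

Definition mevE := (mevalD, mevalB, mevalM, mevalN, mevalZ, mevalC, mevalXU).

Lemma mevFVI (a0 et e1 aoo : K) X
    (X0 := X 0 vi_0) (Xt := X 0 vi_t) (X1 := X 0 vi_1) :
  mev (FVI a0 et e1 aoo) X =
  X0 * Xt * X1 + X0 ^+ 2 + Xt ^+ 2 + X1 ^+ 2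
  - (a0 * aoo + (et + et^-1) * (e1 + e1^-1)) * X0
  - ((et + et^-1) * aoo + a0 * (e1 + e1^-1)) * Xt
  - ((e1 + e1^-1) * aoo + a0 * (et + et^-1)) * X1
  + (a0 * (et + et^-1) * (e1 + e1^-1) * aoo + a0 ^+ 2 + (et + et^-1) ^+ 2
     + (e1 + e1^-1) ^+ 2 + aoo ^+ 2 - 4%:R).
Proof. by rewrite /mev /FVI !expr2 !mevE. Qed.

Lemma mevFV (a0 te1 aoo : K) x
    (x0 := x 0 v_0) (x1 := x 0 v_1) (xoo := x 0 v_oo) :
  mev (FV a0 te1 aoo) x =
  x0 * x1 * xoo + x0 ^+ 2 + xoo ^+ 2 - (a0 + te1 * aoo) * x0 - te1 * x1
  - (aoo + te1 * a0) * xoo + (1 + te1 * a0 * aoo + te1 ^+ 2).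
Proof. by rewrite /mev /FV !expr2 !mevE. Qed.

Definition mderE :=
  (mderivD, mderivB, mderivM, mderivN, mderivZ, mderivC, mderivXU).

Lemma dFVI_0 (a0 et e1 aoo : K) X : mev (FVI a0 et e1 aoo)^`M(vi_0) X =
  X 0 vi_t * X 0 vi_1 + X 0 vi_0 *+ 2
  - (a0 * aoo + (et + et^-1) * (e1 + e1^-1)).
Proof. by rewrite /mev /FVI !expr2 !mderE !mevE /=; ring. Qed.

Lemma dFVI_t (a0 et e1 aoo : K) X : mev (FVI a0 et e1 aoo)^`M(vi_t) X =
  X 0 vi_0 * X 0 vi_1 + X 0 vi_t *+ 2
  - ((et + et^-1) * aoo + a0 * (e1 + e1^-1)).
Proof. by rewrite /mev /FVI !expr2 !mderE !mevE /=; ring. Qed.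

Lemma dFVI_1 (a0 et e1 aoo : K) X : mev (FVI a0 et e1 aoo)^`M(vi_1) X =
  X 0 vi_0 * X 0 vi_t + X 0 vi_1 *+ 2
  - ((e1 + e1^-1) * aoo + a0 * (et + et^-1)).
Proof. by rewrite /mev /FVI !expr2 !mderE !mevE /=; ring. Qed.

Lemma dFV_0 (a0 te1 aoo : K) x : mev (FV a0 te1 aoo)^`M(v_0) x =
  x 0 v_1 * x 0 v_oo + x 0 v_0 *+ 2 - (a0 + te1 * aoo).
Proof. by rewrite /mev /FV !expr2 !mderE !mevE /=; ring. Qed.

Lemma dFV_1 (a0 te1 aoo : K) x : mev (FV a0 te1 aoo)^`M(v_1) x =
  x 0 v_0 * x 0 v_oo - te1.
Proof. by rewrite /mev /FV !expr2 !mderE !mevE /=; ring. Qed.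

(** Needed as a polynomial and not only at points, since [Phi_plus] contains this derivative and is
    itself differentiated and substituted. *)
Lemma mderiv_FV_oo (a0 te1 aoo : K) :
  (FV a0 te1 aoo)^`M(v_oo) =
  'X_v_0 * 'X_v_1 + 'X_v_oo *+ 2 - (aoo + te1 * a0)%:MP.
Proof.
rewrite /FV !expr2 !mderE /= mpolyC0 mpolyC1 -mul_mpolyC.
rewrite -[a in _ + a]mulr1 -[(_ *: 1)]mul_mpolyC.
ring.
Qed.

Lemma dFV_oo (a0 te1 aoo : K) x : mev (FV a0 te1 aoo)^`M(v_oo) x =
  x 0 v_0 * x 0 v_1 + x 0 v_oo *+ 2 - (aoo + te1 * a0).
Proof. by rewrite /mev /FV !expr2 !mderE !mevE /=; ring. Qed.

Lemma Phi_plus_0 (a0 et e1 aoo : K) x :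
  polymap (Phi_plus a0 et e1 aoo) x 0 vi_0 =
  x 0 v_1.
Proof. by rewrite mxE /mev mevE. Qed.

Lemma Phi_plus_t (a0 et e1 aoo : K) x :
  polymap (Phi_plus a0 et e1 aoo) x 0 vi_t =
  x 0 v_0 / e1 + (x 0 v_oo - mev (FV a0 (et * e1) aoo)^`M(v_oo) x) / et.
Proof. by rewrite mxE /mev !mevE /=; ring. Qed.

Lemma Phi_plus_1 (a0 et e1 aoo : K) x :
  polymap (Phi_plus a0 et e1 aoo) x 0 vi_1 =
  x 0 v_oo / e1 + x 0 v_0 / et.
Proof. by rewrite mxE /mev !mevE /=; ring. Qed.

Definition PhiE := (Phi_plus_0, Phi_plus_t, Phi_plus_1).

Lemma sum_ord3 (f : 'I_3 -> K) : \sum_i f i = f v_0 + f v_1 + f v_oo.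
Proof.
rewrite !big_ord_recl big_ord0 addr0 addrA.
by congr (_ + _ + _); congr (f _); apply: val_inj.
Qed.

Lemma dPhi_plus_0 (a0 et e1 aoo : K) x u :
  dpolymap (Phi_plus a0 et e1 aoo) x u 0 vi_0 = u 0 v_1.
Proof. by rewrite mxE sum_ord3 /mev !mderE !mevE /=; ring. Qed.

Lemma dPhi_plus_t (a0 et e1 aoo : K) x u :
  dpolymap (Phi_plus a0 et e1 aoo) x u 0 vi_t =
  u 0 v_0 / e1 + (u 0 v_oo - (x 0 v_1 * u 0 v_0 + x 0 v_0 * u 0 v_1
                              + u 0 v_oo *+ 2)) / et.
Proof.
rewrite mxE sum_ord3 /mev /tnth /Phi_plus /= mderiv_FV_oo.
by rewrite !mulr2n !mderE !mevE /=; ring.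
Qed.

Lemma dPhi_plus_1 (a0 et e1 aoo : K) x u :
  dpolymap (Phi_plus a0 et e1 aoo) x u 0 vi_1 = u 0 v_oo / e1 + u 0 v_0 / et.
Proof. by rewrite mxE sum_ord3 /mev !mderE !mevE /=; ring. Qed.

Definition dPhiE := (dPhi_plus_0, dPhi_plus_t, dPhi_plus_1).

Lemma Fricke_Phi_plus (a0 et e1 aoo : K) : et != 0 -> e1 != 0 ->
  FVI a0 et e1 aoo \mPo Phi_plus a0 et e1 aoo =
  (- 1 / (et * e1)) *:
    (('X_v_1 - (et / e1 + e1 / et)%:MP) * FV a0 (et * e1) aoo).
Proof.
(* The identity is checked in the fraction field of the polynomial ring. [M] embeds the constants
   there, and its morphism laws carry the embedding down to the single parameters. *)
move=> et0 e10; apply/eqP; rewrite -tofrac_eq; apply/eqP.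
pose M (c : K) := tofrac (c%:MP : {mpoly K[3]}).
have MD : {morph M : a b / a + b} by move=> a b; rewrite /M rmorphD /= rmorphD.
have MN : {morph M : a / - a} by move=> a; rewrite /M rmorphN /= rmorphN.
have MM : {morph M : a b / a * b} by move=> a b; rewrite /M rmorphM /= rmorphM.
have M1 : M 1 = 1 by rewrite /M !rmorph1.
have MV c : M c^-1 = (M c)^-1.
  have [->|c0] := eqVneq c 0; first by rewrite invr0 /M !rmorph0 invr0.
  have Mc0 : M c != 0 by rewrite tofrac_eq0 mpolyC_eq0.
  by apply: (mulfI Mc0); rewrite -MM !mulfV.
have TN : {morph @tofrac {mpoly K[3]} : a / - a} by move=> a; rewrite rmorphN.
have TM : {morph @tofrac {mpoly K[3]} : a b / a * b}.
  by move=> a b; rewrite rmorphM.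
have TD : {morph @tofrac {mpoly K[3]} : a b / a + b}.
  by move=> a b; rewrite rmorphD.
have TC c : tofrac (c%:MP : {mpoly K[3]}) = M c by [].
rewrite /FVI !expr2 /=.
rewrite !(comp_mpolyD, comp_mpolyB, comp_mpolyC, comp_mpolyZ, comp_mpolyN,
          rmorphM) /= !comp_mpolyXU /=.
rewrite mderiv_FV_oo /FV -!mul_mpolyC !mulr2n ?expr2.
rewrite !(TM, TD, TN, TC).
clearbody M.
move: (tofrac 'X_v_0) (tofrac 'X_v_1) (tofrac 'X_v_oo) => x0 x1 xoo.
rewrite !(MD, MM, MN, MV, M1).
have M0 c : c != 0 -> M c != 0.
  move=> c0; apply/eqP => Mc0; have := oner_neq0 {fraction {mpoly K[3]}}.
  by rewrite -M1 -(mulfV c0) MM Mc0 mul0r eqxx.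
exact: Fricke_identity (M0 _ et0) (M0 _ e10).
Qed.

Lemma mevFVI_Phi_plus (a0 et e1 aoo : K) x : et != 0 -> e1 != 0 ->
  mev (FVI a0 et e1 aoo) (polymap (Phi_plus a0 et e1 aoo) x) =
  - 1 / (et * e1)
  * ((x 0 v_1 - (et / e1 + e1 / et)) * mev (FV a0 (et * e1) aoo) x).
Proof.
move=> et0 e10.
have -> : mev (FVI a0 et e1 aoo) (polymap (Phi_plus a0 et e1 aoo) x) =
    mev (FVI a0 et e1 aoo \mPo Phi_plus a0 et e1 aoo) x.
  rewrite /mev comp_mpoly_meval; apply: meval_eq => i.
  by rewrite mxE.
by rewrite Fricke_Phi_plus// /mev !mevE.
Qed.

End EvalFV.

(** * Density of the complement of a fibre in a monic quadratic hypersurface *)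

(** A nonzero [p] would leave a non-root of [p * ('X - c%:P)], since an algebraically closed field
    is infinite. *)
Lemma closed_poly_cofinite_eq0 (K : closedFieldType) (c : K) (p : {poly K}) :
  (forall s, s != c -> p.[s] = 0) -> p = 0.
Proof.
move=> p0; apply/eqP/negPn/negP => pn0.
have /closed_nonrootP[s] : p * ('X - c%:P) != 0.
  by rewrite mulf_neq0 ?polyXsubC_eq0.
by rewrite rootM root_XsubC negb_or => /andP[/eqP ps /p0 /ps].
Qed.

(* The trace and the norm of A z + B over the two roots z vanish for s != c,
   hence also at s = c. *)
Lemma linear_on_quadratic (K : closedFieldType) (b d A B : {poly K}) (c y : K) :
  (forall s z, s != c -> z ^+ 2 + b.[s] * z + d.[s] = 0 ->
     A.[s] * z + B.[s] = 0) ->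
  y ^+ 2 + b.[c] * y + d.[c] = 0 -> A.[c] * y + B.[c] = 0.
Proof.
move=> AB0 yc.
pose tr := B *+ 2 - A * b; pose nm := B ^+ 2 - A * B * b + A ^+ 2 * d.
have [tr0 nm0] : tr = 0 /\ nm = 0.
  suff trnm0 s : s != c -> tr.[s] = 0 /\ nm.[s] = 0.
    by split; apply: (@closed_poly_cofinite_eq0 _ c) => s /trnm0[].
  move=> sc.
  have [//|z zs] := @solve_monicpoly K 2 (fun i => [:: - d.[s]; - b.[s]]`_i).
  move: zs; rewrite !big_ord_recl big_ord0 /= expr0 mulr1 addr0 expr1 => zs.
  have z1 : z ^+ 2 + b.[s] * z + d.[s] = 0 by rewrite zs; ring.
  (* By Vieta, [- b.[s] - z] is the other root. *)
  have z2 : (- b.[s] - z) ^+ 2 + b.[s] * (- b.[s] - z) + d.[s] = 0.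
    by rewrite -[RHS]z1; ring.
  have := AB0 _ _ sc z2; have := AB0 _ _ sc z1.
  rewrite /tr /nm !hornerE => E1 E2; split.
    transitivity ((A.[s] * z + B.[s]) + (A.[s] * (- b.[s] - z) + B.[s])).
      by ring.
    by rewrite E1 E2 addr0.
  transitivity ((A.[s] * z + B.[s]) * (A.[s] * (- b.[s] - z) + B.[s])
                + A.[s] ^+ 2 * (z ^+ 2 + b.[s] * z + d.[s])); first by ring.
  by rewrite E1 z1 mul0r mulr0 addr0.
have trc : tr.[c] = 0 by rewrite tr0 horner0.
have nmc : nm.[c] = 0 by rewrite nm0 horner0.
(* [A y + B] is a root of T^2 - tr T + nm, so its square vanishes with the trace and the norm. *)
apply/eqP; rewrite -sqrf_eq0; apply/eqP.
transitivity ((A.[c] * y + B.[c]) * tr.[c] - nm.[c]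
              + A.[c] ^+ 2 * (y ^+ 2 + b.[c] * y + d.[c])).
  by rewrite /tr /nm !hornerE; ring.
by rewrite trc nmc yc !mulr0 subrr addr0.
Qed.

(** Division by the monic [Q] leaves a remainder of degree at most one in the outer variable with
    the same values on [Q = 0]; this is the linear case. *)
Lemma poly_on_quadratic (K : closedFieldType) (b d : {poly K})
    (P : {poly {poly K}}) (c y : K) :
  (forall s z, s != c -> z ^+ 2 + b.[s] * z + d.[s] = 0 ->
     P.[z%:P].[s] = 0) ->
  y ^+ 2 + b.[c] * y + d.[c] = 0 -> P.[y%:P].[c] = 0.
Proof.
pose Q : {poly {poly K}} := 'X^2 + b *: 'X + d%:P.
have sQ : (size (b *: 'X + d%:P : {poly {poly K}})%R < 3)%N.
  rewrite (leq_ltn_trans (size_polyD _ _))// gtn_max.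
  rewrite (leq_ltn_trans (size_scale_leq _ _)) ?size_polyX//.
  by rewrite (leq_ltn_trans (size_polyC_leq1 _)).
have Qm : Q \is monic.
  by rewrite monicE /Q -addrA lead_coefDl ?size_polyXn// lead_coefXn.
have QE s z : Q.[z%:P].[s] = z ^+ 2 + b.[s] * z + d.[s].
  by rewrite /Q !hornerE.
have sR : (size (rmodp P Q) <= 2)%N.
  rewrite -ltnS (leq_trans (ltn_rmodpN0 _ (monic_neq0 Qm)))//.
  by rewrite /Q -addrA size_polyDl ?size_polyXn.
have RE s z : z ^+ 2 + b.[s] * z + d.[s] = 0 ->
    P.[z%:P].[s] = ((rmodp P Q)`_1).[s] * z + ((rmodp P Q)`_0).[s].
  rewrite -QE => Q0; rewrite {1}(rdivp_eq Qm P) hornerD hornerM hornerD hornerM.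
  rewrite Q0 mulr0 add0r (horner_coef_wide _ sR) !big_ord_recl big_ord0 addr0.
  by rewrite !hornerE addrC.
move=> P0 yc; rewrite RE//; apply: (@linear_on_quadratic _ b d) yc => s z sc zs.
by rewrite -RE// P0.
Qed.

(* The hypotheses say that h parametrizes a plane on which F restricts to the
   monic quadratic polynomial 'X^2 + b 'X + d with coefficients in K[s]. *)
Lemma quadratic_zdense (K : closedFieldType) n (F p : {mpoly K[n]})
    (h : 'I_n -> {poly {poly K}}) (b d : {poly K}) (c y : K)
    (pt := fun s z => \row_i (h i).[z%:P].[s] : 'rV[K]_n) :
  (forall s z, mev F (pt s z) = z ^+ 2 + b.[s] * z + d.[s]) ->
  (forall s z, s != c -> mev F (pt s z) = 0 -> mev p (pt s z) = 0) ->
  mev F (pt c y) = 0 -> mev p (pt c y) = 0.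
Proof.
move=> FE p0; rewrite FE => yc.
have pE s z : mev p (pt s z) = (mmap (polyC \o polyC) h p).[z%:P].[s].
  by rewrite horner2_mmap; apply: meval_eq => i; rewrite mxE.
rewrite pE; apply: (@poly_on_quadratic _ b d) yc => s z sc zs.
by rewrite -pE p0// FE.
Qed.

(** * Coordinates of 3-space; regular functions and morphisms *)

Lemma ord3_ind (P : 'I_3 -> Prop) : P v_0 -> P v_1 -> P v_oo -> forall i, P i.
Proof.
move=> P0 P1 P2 [[|[|[|//]]] lt_i3].
- by rewrite (_ : Ordinal _ = v_0)//; apply: val_inj.
- by rewrite (_ : Ordinal _ = v_1)//; apply: val_inj.
- by rewrite (_ : Ordinal _ = v_oo)//; apply: val_inj.
Qed.

Lemma row3_eq (R : Type) (x y : 'rV[R]_3) :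
  x 0 v_0 = y 0 v_0 -> x 0 v_1 = y 0 v_1 -> x 0 v_oo = y 0 v_oo -> x = y.
Proof. by move=> *; apply/rowP; apply: ord3_ind. Qed.

Section Regular.
Context (K : fieldType).

Lemma regular_quotient n (S : set 'rV[K]_n) (f : 'rV[K]_n -> K) A B :
  (forall x, S x -> mev B x != 0) ->
  (forall x, S x -> f x = mev A x / mev B x) -> regular_on S f.
Proof.
move=> B0 fE x Sx; exists A, B.
by split=> [|y Sy _]; [apply: B0|apply: fE].
Qed.

Lemma regular_poly n (S : set 'rV[K]_n) (f : 'rV[K]_n -> K) A :
  (forall x, S x -> f x = mev A x) -> regular_on S f.
Proof.
move=> fE; apply: (@regular_quotient _ _ _ A 1) => x Sx.
  by rewrite /mev meval1 oner_eq0.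
by rewrite /mev meval1 divr1 fE.
Qed.

Lemma regular_onS n (S S' : set 'rV[K]_n) (f : 'rV[K]_n -> K) :
  S' `<=` S -> regular_on S f -> regular_on S' f.
Proof.
move=> S'S fr x /S'S /fr[A [B [B0 fE]]]; exists A, B.
by split=> // y /S'S; apply: fE.
Qed.

Lemma morphism_onS m n (S S' : set 'rV[K]_m) (T T' : set 'rV[K]_n) f :
  S' `<=` S -> (forall x, S' x -> T' (f x)) ->
  morphism_on S T f -> morphism_on S' T' f.
Proof. by move=> S'S fT' [_ fr]; split=> // i; apply: regular_onS (fr i). Qed.

Lemma morphism_polymap m n (q : n.-tuple {mpoly K[m]})
    (S : set 'rV[K]_m) (T : set 'rV[K]_n) :
  (forall x, S x -> T (polymap q x)) -> morphism_on S T (polymap q).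
Proof.
split=> // i; apply: (@regular_poly _ _ _ (tnth q i)) => x _.
by rewrite mxE.
Qed.

End Regular.

(** * Residue forms on tangent planes *)

Section Forms.
Context (K : fieldType).

(* The cross product of two vectors orthogonal to a nonzero gradient is a
   multiple of that gradient. *)
Lemma tangent_wedge (G : {mpoly K[3]}) (x u v : 'rV[K]_3) :
  smooth_at G x -> tangent_at G x u -> tangent_at G x v ->
  exists l, [/\ wedge v_0 v_1 u v = l * mev G^`M(v_oo) x,
                wedge v_1 v_oo u v = l * mev G^`M(v_0) x &
                wedge v_oo v_0 u v = l * mev G^`M(v_1) x].
Proof.
case=> i Gi.
pose G0 := mev G^`M(v_0) x; pose G1 := mev G^`M(v_1) x.
pose Goo := mev G^`M(v_oo) x.
pose dot (w : 'rV[K]_3) := G0 * w 0 v_0 + G1 * w 0 v_1 + Goo * w 0 v_oo.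
rewrite /tangent_at !sum_ord3 -!/(dot _) => Tu Tv.
set W01 := wedge v_0 v_1 u v; set W1o := wedge v_1 v_oo u v.
set Wo0 := wedge v_oo v_0 u v.
have dot0 (p q : K) : p * dot u - q * dot v = 0 by rewrite Tu Tv !mulr0 subrr.
have R1 : W01 * G0 = W1o * Goo.
  apply/eqP; rewrite -subr_eq0 -(dot0 (v 0 v_1) (u 0 v_1)); apply/eqP.
  by rewrite /W01 /W1o /wedge /dot; ring.
have R2 : W01 * G1 = Wo0 * Goo.
  apply/eqP; rewrite -subr_eq0 -(dot0 (- v 0 v_0) (- u 0 v_0)); apply/eqP.
  by rewrite /W01 /Wo0 /wedge /dot; ring.
have R3 : Wo0 * G0 = W1o * G1.
  apply/eqP; rewrite -subr_eq0 -(dot0 (- v 0 v_oo) (- u 0 v_oo)); apply/eqP.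
  by rewrite /W1o /Wo0 /wedge /dot; ring.
have div (p q r s : K) : q != 0 -> p * q = r * s -> p = r / q * s.
  by move=> q0 pq; apply: (mulIf q0); rewrite pq mulrAC divfK.
elim/ord3_ind: i Gi => nz0.
- by exists (W1o / G0); split; [apply: div|rewrite divfK|apply: div].
- by exists (Wo0 / G1); split; [apply: div|apply: div|rewrite divfK].
- by exists (W01 / Goo); split; [rewrite divfK|apply: div|apply: div].
Qed.

(** A branch with nonzero denominator simplifies to [l / c], and smoothness excludes that all three
    denominators vanish. Two residue forms can thus be compared through [l] alone. *)
Lemma residue_form_scale (c l : K) (G : {mpoly K[3]}) (i j k : 'I_3)
    (x u v : 'rV[K]_3) :
  (forall h, h \in [:: i; j; k]) -> smooth_at G x ->
  wedge i j u v = l * mev G^`M(k) x -> wedge j k u v = l * mev G^`M(i) x ->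
  wedge k i u v = l * mev G^`M(j) x ->
  residue_form c G i j k x u v = l / c.
Proof.
move=> ijk [h Gh] Wk Wi Wj; rewrite /residue_form Wi Wj Wk.
have E (a : K) : a != 0 -> l * a / (c * a) = l / c.
  by move=> a0; rewrite invfM mulrACA divff// mulr1.
case: ifPn => [/E//|/negPn/eqP k0]; case: ifPn => [/E//|/negPn/eqP j0].
apply: E; move: (ijk h) Gh; rewrite !inE => /or3P[]/eqP->//.
  by rewrite j0 eqxx.
by rewrite k0 eqxx.
Qed.
End Forms.

(** * Phi and the two charts of its inverse *)

Section Charts.
Context (K : fieldType) (a0 et e1 aoo : K).
Hypotheses (et0 : et != 0) (e10 : e1 != 0).
Implicit Types (x X : 'rV[K]_3).

Let F := FVI a0 et e1 aoo.
Let tF := FV a0 (et * e1) aoo.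
Let Phi := polymap (Phi_plus a0 et e1 aoo).
Let d1 X := den1 et e1 X.
Let d2 X := den2 a0 et e1 aoo X.
Let m X := et * X 0 vi_t + e1 * X 0 vi_1 - aoo - et * e1 * a0.

Let nz := (et0, e10).

(* The chart of the inverse on d2 != 0; the last coordinate comes from the
   formula for X_1. *)
Definition Psi' X : 'rV[K]_3 :=
  let w := Psi_0' a0 et e1 aoo X in
  \row_i tnth [tuple w; X 0 vi_0; e1 * X 0 vi_1 - e1 / et * w] i.

Lemma PsiE X : [/\ Psi a0 et e1 aoo X 0 v_0 = Psi_0 a0 et e1 aoo X,
  Psi a0 et e1 aoo X 0 v_1 = X 0 vi_0 &
  Psi a0 et e1 aoo X 0 v_oo = Psi_oo a0 et e1 aoo X].
Proof. by split; rewrite mxE. Qed.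

Lemma Psi'E X : [/\ Psi' X 0 v_0 = Psi_0' a0 et e1 aoo X,
  Psi' X 0 v_1 = X 0 vi_0 &
  Psi' X 0 v_oo = e1 * X 0 vi_1 - e1 / et * Psi_0' a0 et e1 aoo X].
Proof. by split; rewrite mxE. Qed.

(* On X_0 = et/e1 + e1/et this is the splitting of the cubic into two lines. *)
Lemma FVI_factor X : et * e1 * mev F X =
  m X * d2 X - et * e1 * (d1 X * (d1 X - mev F^`M(vi_0) X)).
Proof.
rewrite mevFVI dFVI_0 /m /d1 /d2 /den1 /den2.
move: (X 0 vi_0) (X 0 vi_t) (X 0 vi_1) => X0 Xt X1; field.
by rewrite !nz.
Qed.

Lemma dF_Phi_0 x : mev tF x = 0 -> mev F^`M(vi_0) (Phi x) =
  x 0 v_0 / et * (mev tF^`M(v_0) x / e1 - mev tF^`M(v_oo) x / et)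
  - mev tF^`M(v_1) x / (et * e1) * (x 0 v_1 - et / e1 - e1 / et).
Proof.
move=> tFx; apply/eqP; rewrite -subr_eq0; apply/eqP.
(* The two sides differ by [- tF / (et * e1)], so this formula, unlike the next two, uses
   [tF = 0]. *)
rewrite -[RHS](mulr0 (- (et * e1)^-1)) -[X in _ = _ * X]tFx.
rewrite dFVI_0 !PhiE mevFV dFV_0 dFV_1 dFV_oo.
move: (x 0 v_0) (x 0 v_1) (x 0 v_oo) => x0 x1 xoo; field.
by rewrite !nz.
Qed.

Lemma dF_Phi_t x : mev F^`M(vi_t) (Phi x) =
  mev tF^`M(v_0) x / e1 - mev tF^`M(v_oo) x / et.
Proof.
rewrite dFVI_t !PhiE dFV_0 dFV_oo.
move: (x 0 v_0) (x 0 v_1) (x 0 v_oo) => x0 x1 xoo; field.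
by rewrite !nz.
Qed.

Lemma dF_Phi_1 x : mev F^`M(vi_1) (Phi x) =
  mev tF^`M(v_0) x / et + mev tF^`M(v_oo) x / e1
  - x 0 v_1 * mev tF^`M(v_oo) x / et.
Proof.
rewrite dFVI_1 !PhiE dFV_0 dFV_oo.
move: (x 0 v_0) (x 0 v_1) (x 0 v_oo) => x0 x1 xoo; field.
by rewrite !nz.
Qed.

Lemma d1_Phi x : d1 (Phi x) = x 0 v_1 - et / e1 - e1 / et.
Proof. by rewrite /d1 /den1 PhiE. Qed.

Lemma m_Phi x : m (Phi x) = - x 0 v_0 * d1 (Phi x).
Proof.
rewrite d1_Phi /m !PhiE dFV_oo; field.
by rewrite !nz.
Qed.

(** Where [d1] vanishes, this makes [d2 = 0] equivalent to a proportionality between two partial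
    derivatives of [tF]. *)
Lemma d2_Phi x : d2 (Phi x) =
  mev tF^`M(v_0) x - e1 / et * mev tF^`M(v_oo) x - x 0 v_oo * d1 (Phi x).
Proof.
rewrite d1_Phi /d2 /den2 !PhiE dFV_0 dFV_oo; field.
by rewrite !nz.
Qed.

(** The right-hand side solves X_1 = x_oo/e1 + x_0/et for x_oo, the form of the last coordinate that
    both charts share. *)
Lemma Psi_ooE X : d1 X != 0 ->
  Psi_oo a0 et e1 aoo X = e1 * X 0 vi_1 - e1 / et * Psi_0 a0 et e1 aoo X.
Proof.
move=> d1X; apply: (mulIf d1X); rewrite mulrBl.
rewrite -[_ * Psi_0 _ _ _ _ _ * _]mulrA /Psi_oo /Psi_0 !mulNr !divfK//.
rewrite dFVI_t /d1 /den1. field.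
by rewrite !nz.
Qed.

Lemma Psi_Phi x : d1 (Phi x) != 0 -> Psi a0 et e1 aoo (Phi x) = x.
Proof.
move=> d1x; have [P0 P1 Poo] := PsiE (Phi x).
have x0E : Psi_0 a0 et e1 aoo (Phi x) = x 0 v_0.
  by rewrite /Psi_0 -/(m _) m_Phi !mulNr opprK mulfK.
apply: row3_eq; rewrite ?P0 ?P1 ?Poo ?PhiE// Psi_ooE// x0E PhiE; field.
by rewrite !nz.
Qed.

(** The hypotheses are the equations [Phi x = X] after elimination, without division by [d1], so
    that both charts can use them. *)
Lemma Phi_chart X x : x 0 v_1 = X 0 vi_0 ->
  x 0 v_oo = e1 * X 0 vi_1 - e1 / et * x 0 v_0 -> x 0 v_0 * d1 X = - m X ->
  Phi x = X.
Proof.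
move=> x1E xooE x0E; apply: row3_eq; rewrite PhiE//.
  rewrite dFV_oo xooE x1E; apply/eqP; rewrite -subr_eq0; apply/eqP.
  transitivity (- (et^-1) * (x 0 v_0 * d1 X + m X)).
    by rewrite /d1 /den1 /m; field; rewrite !nz.
  by rewrite x0E addNr mulr0.
by rewrite xooE; field; rewrite !nz.
Qed.

Lemma Phi_Psi X : d1 X != 0 -> Phi (Psi a0 et e1 aoo X) = X.
Proof.
move=> d1X; have [P0 P1 Poo] := PsiE X.
apply: Phi_chart; rewrite ?P0 ?P1 ?Poo//; first exact: Psi_ooE.
by rewrite /Psi_0 mulNr divfK.
Qed.

(** In the Fricke relation the factor [d1] is invertible, so [F = 0] forces [tF = 0]. *)
Lemma tF_Psi X : mev F X = 0 -> d1 X != 0 -> mev tF (Psi a0 et e1 aoo X) = 0.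
Proof.
move=> FX d1X; have := mevFVI_Phi_plus a0 aoo (Psi a0 et e1 aoo X) et0 e10.
have k0 : - 1 / (et * e1) != 0.
  by rewrite mulf_neq0 ?oppr_eq0 ?oner_eq0 ?invr_eq0 ?mulf_neq0.
have [_ P1 _] := PsiE X.
rewrite -/Phi Phi_Psi// -/F FX P1 opprD addrA => /esym/eqP.
by rewrite mulf_eq0 (negbTE k0) mulf_eq0 (negbTE d1X) => /eqP.
Qed.

Lemma Psi_0'E X : d2 X != 0 -> Psi_0' a0 et e1 aoo X * d2 X =
  - (et * e1 * (d1 X - mev F^`M(vi_0) X)).
Proof. by move=> d2X; rewrite /Psi_0' mulNr divfK. Qed.

(** By [FVI_factor], the second expression satisfies the defining equation of the first one even
    where [d1 = 0]. *)
Lemma Psi_0'_d1 X : mev F X = 0 -> d2 X != 0 ->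
  Psi_0' a0 et e1 aoo X * d1 X = - m X.
Proof.
move=> FX d2X; apply: (mulIf d2X); rewrite mulrAC Psi_0'E//.
have := FVI_factor X; rewrite FX mulr0 => /esym/eqP; rewrite subr_eq0 => /eqP.
by rewrite !mulNr => ->; ring.
Qed.

Lemma Psi_0_Psi_0' X : mev F X = 0 -> d1 X != 0 -> d2 X != 0 ->
  Psi_0 a0 et e1 aoo X = Psi_0' a0 et e1 aoo X.
Proof.
move=> FX d1X d2X; apply: (mulIf d1X).
by rewrite Psi_0'_d1// /Psi_0 mulNr divfK.
Qed.

Lemma Phi_Psi' X : mev F X = 0 -> d2 X != 0 -> Phi (Psi' X) = X.
Proof.
move=> FX d2X; have [P0 P1 Poo] := Psi'E X.
by apply: Phi_chart; rewrite ?P0 ?P1 ?Poo// Psi_0'_d1.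
Qed.

Lemma tF_Psi' X : mev F X = 0 -> d2 X != 0 -> mev tF (Psi' X) = 0.
Proof.
move=> FX d2X; have [P0 P1 Poo] := Psi'E X.
rewrite mevFV P0 P1 Poo; set w := Psi_0' _ _ _ _ _.
have E1 : w * d1 X + m X = 0 by rewrite Psi_0'_d1// addNr.
have E2 : w * d2 X + et * e1 * (d1 X - mev F^`M(vi_0) X) = 0.
  by rewrite Psi_0'E// addNr.
(* The Fricke relation says nothing about [tF] at [d1 = 0]; instead [tF] is a combination of the
   equations [E1] and [E2], with the last coordinate as coefficient of [E1]. *)
transitivity ((w * d2 X + et * e1 * (d1 X - mev F^`M(vi_0) X))
  + (e1 * X 0 vi_1 - e1 / et * w) * (w * d1 X + m X)).
  rewrite dFVI_0 /m /d1 /d2 /den1 /den2; field.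
  by rewrite !nz.
by rewrite E1 E2 mulr0 addr0.
Qed.

Lemma Psi_0'_Phi x : mev tF x = 0 -> d2 (Phi x) != 0 ->
  x 0 v_0 = Psi_0' a0 et e1 aoo (Phi x).
Proof.
move=> tFx d2x; apply: (mulIf d2x); rewrite Psi_0'E//.
rewrite d2_Phi dF_Phi_0// d1_Phi.
rewrite dFV_0 dFV_1 dFV_oo; field.
by rewrite !nz.
Qed.

Lemma Psi'_Phi x : mev tF x = 0 -> d2 (Phi x) != 0 -> Psi' (Phi x) = x.
Proof.
move=> tFx d2x; have [P0 P1 Poo] := Psi'E (Phi x).
apply: row3_eq; rewrite ?P0 ?P1 ?Poo -?Psi_0'_Phi ?PhiE//; field.
by rewrite !nz.
Qed.

(** * Gluing the charts into a regular inverse off [L] *)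

Let L := L0 a0 et e1 aoo.
Let SVI := hypersurface F.
Let SV := hypersurface tF.

Definition den1P : {mpoly K[3]} := 'X_vi_0 - (et / e1)%:MP - (e1 / et)%:MP.

Definition den2P : {mpoly K[3]} :=
  e1 *: 'X_vi_t + et *: 'X_vi_1 - a0%:MP - (et * e1 * aoo)%:MP.

Lemma mev_den1P X : mev den1P X = d1 X.
Proof. by rewrite /mev !mevE. Qed.

Lemma mev_den2P X : mev den2P X = d2 X.
Proof. by rewrite /mev !mevE. Qed.

Lemma L0P X : L X <-> d1 X = 0 /\ d2 X = 0.
Proof.
rewrite /L /L0 /= /d1 /d2 /den1 /den2; split=> [[-> ->]|[E1 E2]].
  by split; ring.
split; first by apply/eqP; rewrite -subr_eq0 opprD addrA E1.
by apply/eqP; rewrite -subr_eq0 opprD addrA E2.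
Qed.

Lemma notL0P X : ~ L X <-> d1 X != 0 \/ d2 X != 0.
Proof.
rewrite L0P; split=> [|[/eqP|/eqP] n0 []//].
have [d1X|] := eqVneq (d1 X) 0; last by left.
by have [d2X nL|] := eqVneq (d2 X) 0; [case: nL|right].
Qed.

(** Each term of [FVI_factor] contains [d1] or [d2]. *)
Lemma L0_sub : L `<=` SVI.
Proof.
move=> X /L0P[d1X d2X]; rewrite /SVI /hypersurface /=.
apply: (mulfI (mulf_neq0 et0 e10)).
by rewrite FVI_factor d1X d2X !mulr0 mul0r mulr0 subrr.
Qed.

Lemma SVI_Phi x : SV x -> SVI (Phi x).
Proof.
rewrite /SV /SVI /hypersurface /= => tFx.
by rewrite mevFVI_Phi_plus// -/tF tFx !mulr0.
Qed.

Lemma zopen_notL0 : zopen_in SVI (SVI `\` L).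
Proof.
exists [set den1P; den2P]; rewrite (_ : zero_locus _ = L)//.
apply/seteqP; split=> X.
  move=> ZX; apply/L0P; rewrite -mev_den1P -mev_den2P.
  by split; apply: ZX; [left|right].
by move=> /L0P[d1X d2X] p [->|->]; rewrite ?mev_den1P ?mev_den2P.
Qed.

Lemma zopen_d1 : zopen_in SVI (SVI `&` [set X | d1 X != 0]).
Proof.
exists [set den1P]; apply/seteqP; split=> X [FX].
  by move=> /eqP d1X; split=> // /(_ _ erefl); rewrite mev_den1P.
move=> nZ; split=> //; apply/eqP => d1X; apply: nZ => p ->.
by rewrite mev_den1P.
Qed.

Definition Phi_inv X :=
  if d1 X != 0 then Psi a0 et e1 aoo X else Psi' X.

Lemma Phi_inv1 X : d1 X != 0 -> Phi_inv X = Psi a0 et e1 aoo X.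
Proof. by rewrite /Phi_inv => ->. Qed.

(** The charts agree on their overlap, so [Psi'] may be used wherever [d2] is nonzero, whatever [d1]
    is. *)
Lemma Phi_inv2 X : SVI X -> d2 X != 0 -> Phi_inv X = Psi' X.
Proof.
move=> FX d2X; rewrite /Phi_inv; case: ifPn => // d1X.
have [P0 P1 Poo] := PsiE X; have [Q0 Q1 Qoo] := Psi'E X.
have eq0 : Psi_0 a0 et e1 aoo X = Psi_0' a0 et e1 aoo X by apply: Psi_0_Psi_0'.
by apply: row3_eq; rewrite ?P0 ?P1 ?Poo ?Q0 ?Q1 ?Qoo ?Psi_ooE// eq0.
Qed.

Lemma SV_Phi_inv X : SVI X -> ~ L X -> SV (Phi_inv X).
Proof.
move=> FX /notL0P[d1X|d2X].
  by rewrite /SV /hypersurface /= Phi_inv1// tF_Psi.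
by rewrite /SV /hypersurface /= Phi_inv2// tF_Psi'.
Qed.

Lemma Phi_invK X : SVI X -> ~ L X -> Phi (Phi_inv X) = X.
Proof.
move=> FX /notL0P[d1X|d2X]; first by rewrite Phi_inv1// Phi_Psi.
by rewrite Phi_inv2// Phi_Psi'.
Qed.

Lemma PhiK x : SV x -> ~ L (Phi x) -> Phi_inv (Phi x) = x.
Proof.
move=> tFx /notL0P[d1X|d2X]; first by rewrite Phi_inv1// Psi_Phi.
by rewrite Phi_inv2//; [exact: Psi'_Phi|exact: SVI_Phi].
Qed.

Lemma regular_Phi_inv i : regular_on (SVI `\` L) (fun X => Phi_inv X 0 i).
Proof.
pose A0 : {mpoly K[3]} :=
  - (et *: 'X_vi_t + e1 *: 'X_vi_1 - aoo%:MP - (et * e1 * a0)%:MP).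
pose Aoo : {mpoly K[3]} := - (den2P - e1 *: F^`M(vi_t)).
pose A0' : {mpoly K[3]} := - ((et * e1) *: (den1P - F^`M(vi_0))).
have A0E X : mev A0 X = - m X by rewrite /mev !mevE.
have AooE X : mev Aoo X = - (d2 X - e1 * mev F^`M(vi_t) X).
  by rewrite -mev_den2P /mev mevalN mevalB mevalZ.
have A0'E X : mev A0' X = - (et * e1 * (d1 X - mev F^`M(vi_0) X)).
  by rewrite -mev_den1P /mev mevalN mevalZ mevalB.
move=> X [FX /notL0P[d1X|d2X]].
  (* The middle coordinate is expanded by [den1P] to give all three the same denominator. *)
  exists (tnth [tuple A0; 'X_vi_0 * den1P; Aoo] i), den1P.
  split=> [|Y [FY _]]; rewrite mev_den1P// => d1Y; rewrite Phi_inv1//.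
  have [P0 P1 Poo] := PsiE Y; elim/ord3_ind: i; rewrite ?P0 ?P1 ?Poo.
  - by rewrite [tnth _ _]/= A0E /Psi_0 mulNr.
  - by rewrite /mev [tnth _ _]/= mevalM mevalXU -/(mev _ _) mev_den1P mulfK.
  - by rewrite [tnth _ _]/= AooE /Psi_oo mulNr.
exists (tnth [tuple A0'; 'X_vi_0 * den2P;
                    e1 *: ('X_vi_1 * den2P) - (e1 / et) *: A0'] i), den2P.
split=> [|Y [FY _]]; rewrite mev_den2P// => d2Y; rewrite Phi_inv2//.
have [P0 P1 Poo] := Psi'E Y; elim/ord3_ind: i; rewrite ?P0 ?P1 ?Poo.
- by rewrite [tnth _ _]/= A0'E /Psi_0' mulNr.
- by rewrite /mev [tnth _ _]/= mevalM mevalXU -/(mev _ _) mev_den2P mulfK.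
- rewrite [tnth _ _]/= /mev mevalB !mevalZ mevalM mevalXU -!/(mev _ _).
  rewrite mev_den2P A0'E /Psi_0' mulrBl [e1 * (_ * _)]mulrA mulfK//.
  by rewrite -[e1 / et * _ / _]mulrA mulNr.
Qed.

Lemma morphism_Phi : morphism_on SV SVI Phi.
Proof. by apply: morphism_polymap => x /SVI_Phi. Qed.

Lemma morphism_Phi_inv : morphism_on (SVI `\` L) SV Phi_inv.
Proof. by split=> [X [FX LX]|]; [apply: SV_Phi_inv|apply: regular_Phi_inv]. Qed.

Lemma isomorphism_Phi : isomorphism_on (SV `\` Phi @^-1` L) (SVI `\` L) Phi.
Proof.
split; first by apply: morphism_onS morphism_Phi => [x []//|x [/SVI_Phi]].
exists Phi_inv; split=> [|x []|X []]; last 2 first.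
- exact: PhiK.
- exact: Phi_invK.
apply: morphism_onS morphism_Phi_inv => // X [FX LX]; split.
  exact: SV_Phi_inv.
by rewrite /preimage /= Phi_invK.
Qed.

Lemma morphism_Psi :
  morphism_on (SVI `&` [set X | d1 X != 0]) SV (Psi a0 et e1 aoo).
Proof.
have sub : SVI `&` [set X | d1 X != 0] `<=` SVI `\` L.
  by move=> X [FX d1X]; split=> //; apply/notL0P; left.
split=> [X [FX d1X]|i]; first exact: tF_Psi.
move=> X /[dup] DX /sub/(regular_Phi_inv i)[A [B [B0 AB]]].
exists A, B; split=> // Y DY BY.
by rewrite -AB//; [rewrite Phi_inv1//; case: DY|apply: sub].
Qed.

Lemma isomorphism_Phi_d1 :
  isomorphism_on (SV `&` [set x | d1 (Phi x) != 0])
    (SVI `&` [set X | d1 X != 0]) Phi.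
Proof.
split.
  by apply: morphism_onS morphism_Phi => [x []//|x [/SVI_Phi]].
exists (Psi a0 et e1 aoo); split=> [|x [_ ?]|X [_ ?]]; last 2 first.
- exact: Psi_Phi.
- exact: Phi_Psi.
apply: morphism_onS morphism_Psi => // X [FX d1X]; split; first exact: tF_Psi.
by rewrite /= Phi_Psi.
Qed.

Lemma zopen_d1_Phi : zopen_in SV (SV `&` [set x | d1 (Phi x) != 0]).
Proof.
pose p : {mpoly K[3]} := 'X_v_1 - (et / e1)%:MP - (e1 / et)%:MP.
have pE x : mev p x = d1 (Phi x) by rewrite d1_Phi /mev !mevE.
exists [set p]; apply/seteqP; split=> x [tFx].
  by move=> /eqP d1x; split=> // /(_ _ erefl); rewrite pE.
move=> nZ; split=> //; apply/eqP => d1x; apply: nZ => _ ->.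
by rewrite pE.
Qed.

Lemma defined_at_notL0 X : SVI X -> ~ L X ->
  defined_at SVI SV (SVI `&` [set X | d1 X != 0]) (Psi a0 et e1 aoo) X.
Proof.
move=> FX LX; exists (SVI `\` L), Phi_inv; split=> //.
- exact: zopen_notL0.
- exact: morphism_Phi_inv.
- by move=> Y _ [_]; apply: Phi_inv1.
Qed.

(** * Smoothness along Phi and the pull-back of the residue form *)

Lemma smooth_at3 (G : {mpoly K[3]}) X : ~ smooth_at G X <->
  [/\ mev G^`M(v_0) X = 0, mev G^`M(v_1) X = 0 & mev G^`M(v_oo) X = 0].
Proof.
split=> [ns|[G0 G1 G2]]; last first.
  by case=> i; elim/ord3_ind: i; rewrite ?G0 ?G1 ?G2 eqxx.
by split; apply/eqP; apply/negPn/negP => nz0; apply: ns; eexists; exact: nz0.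
Qed.

(** By [d2_Phi], the first partial of [tF] is [e1 / et] times the last one, and with [d1 = 0] this
    annihilates all three partials of [F]. Hence Phi avoids [L] when [F] is smooth along [L]. *)
Lemma L0_Phi_singular x : SV x -> L (Phi x) -> ~ smooth_at F (Phi x).
Proof.
move=> tFx /L0P[d1x d2x]; apply/smooth_at3.
have F0 : mev tF^`M(v_0) x = e1 / et * mev tF^`M(v_oo) x.
  by apply: subr0_eq; rewrite -d2x d2_Phi d1x mulr0 subr0.
have x1 : x 0 v_1 = et / e1 + e1 / et.
  by apply/eqP; rewrite -subr_eq0 opprD addrA -d1_Phi d1x.
have Ft : mev tF^`M(v_0) x / e1 - mev tF^`M(v_oo) x / et = 0.
  by rewrite F0; field; rewrite !nz.
split.
- by rewrite [LHS]dF_Phi_0// Ft mulr0 -d1_Phi d1x mulr0 subrr.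
- by rewrite [LHS]dF_Phi_t.
- by rewrite [LHS]dF_Phi_1 F0 x1; field; rewrite !nz.
Qed.

Lemma smooth_Phi x :
  SV x -> smooth_at tF x -> ~ L (Phi x) -> smooth_at F (Phi x).
Proof.
move=> tFx tFs nL.
have [Gt|] := eqVneq (mev F^`M(vi_t) (Phi x)) 0; last by exists vi_t.
have [G1|] := eqVneq (mev F^`M(vi_1) (Phi x)) 0; last by exists vi_1.
have [G0|] := eqVneq (mev F^`M(vi_0) (Phi x)) 0; last by exists vi_0.
move: Gt G1 G0; rewrite dF_Phi_t dF_Phi_1 dF_Phi_0// => Gt G1 G0.
have F0 : mev tF^`M(v_0) x = e1 / et * mev tF^`M(v_oo) x.
  by apply: (mulIf (invr_neq0 e10)); rewrite (subr0_eq Gt); field; rewrite !nz.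
have [d1x|d1x] := eqVneq (d1 (Phi x)) 0.
  by case: nL; apply/L0P; split=> //; rewrite d2_Phi F0 d1x mulr0 subr0 subrr.
(* Given [F0], the equations [G1] and [G0] become [d1] times a partial of [tF], up to a nonzero
   constant. *)
have Foo : mev tF^`M(v_oo) x = 0.
  apply: (mulIf d1x); rewrite mul0r -(mulr0 (- et)) -G1 F0 d1_Phi.
  by field; rewrite !nz.
have F1 : mev tF^`M(v_1) x = 0.
  apply: (mulIf d1x); rewrite mul0r -(mulr0 (- (et * e1))) -G0 Gt d1_Phi.
  by field; rewrite !nz.
suff: ~ smooth_at tF x by [].
by apply/smooth_at3; rewrite F0 Foo F1 mulr0.
Qed.
(** Both forms equal [l / c] for the same [l] from [tangent_wedge]: the 2x2 minors of dPhi send [l]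
    times the gradient of [tF] to [l] times the gradient of [F]. *)
Lemma pullback_omega c x u v : SV x -> smooth_at tF x -> smooth_at F (Phi x) ->
  tangent_at tF x u -> tangent_at tF x v ->
  pullback (Phi_plus a0 et e1 aoo) (residue_form c F vi_t vi_0 vi_1) x u v =
  residue_form c tF v_0 v_1 v_oo x u v.
Proof.
move=> tFx tFs Fs Tu Tv.
have all3 (h : 'I_3) : h \in [:: vi_t; vi_0; vi_1] /\ h \in [:: v_0; v_1; v_oo].
  by elim/ord3_ind: h.
have [l [W01 W1oo Woo0]] := tangent_wedge tFs Tu Tv.
rewrite (residue_form_scale c (fun h => proj2 (all3 h)) tFs W01 W1oo Woo0).
rewrite /pullback.
apply: (residue_form_scale c (fun h => proj1 (all3 h)) Fs).
- rewrite -/Phi dF_Phi_1.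
  transitivity ((e1^-1 - x 0 v_1 / et) * wedge v_0 v_1 u v
                + wedge v_1 v_oo u v / et).
    by rewrite /wedge !dPhiE; ring.
  by rewrite W01 W1oo; ring.
- rewrite -/Phi dF_Phi_t.
  transitivity (wedge v_1 v_oo u v / e1 - wedge v_0 v_1 u v / et).
    by rewrite /wedge !dPhiE; ring.
  by rewrite W01 W1oo; ring.
- rewrite -/Phi dF_Phi_0//.
  transitivity (
    wedge v_oo v_0 u v * (e1^-1 ^+ 2 - x 0 v_1 / (et * e1) + et^-1 ^+ 2)
    + wedge v_1 v_oo u v * x 0 v_0 / (et * e1)
    - wedge v_0 v_1 u v * x 0 v_0 / et ^+ 2).
    by rewrite /wedge !dPhiE; field; rewrite !nz.
  by rewrite W01 W1oo Woo0; field; rewrite !nz.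
Qed.

End Charts.

(** * Algebraically closed fields: density, and indeterminacy along [L] *)

Section Closed.
Context (K : closedFieldType) (a0 et e1 aoo : K).
Hypotheses (et0 : et != 0) (e10 : e1 != 0).
Implicit Types (x X : 'rV[K]_3).

Let F := FVI a0 et e1 aoo.
Let tF := FV a0 (et * e1) aoo.
Let Phi := polymap (Phi_plus a0 et e1 aoo).
Let SVI := hypersurface F.
Let SV := hypersurface tF.
Let D := SVI `&` [set X | den1 et e1 X != 0].
Let L := L0 a0 et e1 aoo.

Lemma zdense_D : zdense_in SVI D.
Proof.
split=> [X []//|J DJ X FX p Jp].
(* The plane through [X] with X_1 fixed: X_0 is the inner variable, and [F] is monic quadratic in
   X_t, the outer one. *)
pose h (i : 'I_3) : {poly {poly K}} :=
  tnth [tuple 'X%:P; 'X; (X 0 vi_1)%:P%:P] i.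
pose pt s z : 'rV[K]_3 := \row_i (h i).[z%:P].[s].
have ptE s z :
    [/\ pt s z 0 vi_0 = s, pt s z 0 vi_t = z & pt s z 0 vi_1 = X 0 vi_1].
  by split; rewrite mxE /h [tnth _ _]/= !hornerE.
have XE : X = pt (X 0 vi_0) (X 0 vi_t).
  by have [P0 Pt P1] := ptE (X 0 vi_0) (X 0 vi_t); apply: row3_eq.
have [X0c|X0c] := eqVneq (X 0 vi_0) (et / e1 + e1 / et); last first.
  apply: (DJ X) => //; split=> //=; apply: contra X0c.
  by rewrite /den1 -addrA -opprD subr_eq0.
rewrite XE X0c.
pose th0 := a0 * aoo + (et + et^-1) * (e1 + e1^-1).
pose tht := (et + et^-1) * aoo + a0 * (e1 + e1^-1).
pose th1 := (e1 + e1^-1) * aoo + a0 * (et + et^-1).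
pose thoo := a0 * (et + et^-1) * (e1 + e1^-1) * aoo + a0 ^+ 2
  + (et + et^-1) ^+ 2 + (e1 + e1^-1) ^+ 2 + aoo ^+ 2 - 4%:R.
pose b : {poly K} := (X 0 vi_1) *: 'X - tht%:P.
pose d : {poly K} := 'X ^+ 2 - th0 *: 'X
  + (X 0 vi_1 ^+ 2 - th1 * X 0 vi_1 + thoo)%:P.
apply: (@quadratic_zdense _ _ F p h b d).
- move=> s z; have [P0 Pt P1] := ptE s z.
  rewrite mevFVI -!/(pt _ _) P0 Pt P1 /b /d.
  rewrite !(hornerD, hornerN, hornerZ, hornerX, hornerXn, hornerC).
  by rewrite /th0 /tht /th1 /thoo; ring.
- move=> s z sc Fs; apply: (DJ (pt s z)) => //; split=> //=.
  have [P0 _ _] := ptE s z.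
  by rewrite /den1 P0 -addrA -opprD subr_eq0.
- by rewrite -X0c -/(pt _ _) -XE.
Qed.

Lemma zdense_D_Phi : zdense_in SV (SV `&` [set x | den1 et e1 (Phi x) != 0]).
Proof.
split=> [x []//|J DJ x Fx p Jp].
(* Here the last coordinate is fixed, and [tF] is monic quadratic in the first one. *)
pose h (i : 'I_3) : {poly {poly K}} :=
  tnth [tuple 'X; 'X%:P; (x 0 v_oo)%:P%:P] i.
pose pt s z : 'rV[K]_3 := \row_i (h i).[z%:P].[s].
have ptE s z :
    [/\ pt s z 0 v_0 = z, pt s z 0 v_1 = s & pt s z 0 v_oo = x 0 v_oo].
  by split; rewrite mxE /h [tnth _ _]/= !hornerE.
have XE : x = pt (x 0 v_1) (x 0 v_0).
  by have [P0 P1 Poo] := ptE (x 0 v_1) (x 0 v_0); apply: row3_eq.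
have [X0c|X0c] := eqVneq (x 0 v_1) (et / e1 + e1 / et); last first.
  apply: (DJ x) => //; split=> //=; apply: contra X0c.
  by rewrite /den1 Phi_plus_0 -addrA -opprD subr_eq0.
rewrite XE X0c.
pose b : {poly K} := (x 0 v_oo) *: 'X - (a0 + et * e1 * aoo)%:P.
pose d : {poly K} := (x 0 v_oo ^+ 2 - (aoo + et * e1 * a0) * x 0 v_oo
  + (1 + et * e1 * a0 * aoo + (et * e1) ^+ 2))%:P - (et * e1) *: 'X.
apply: (@quadratic_zdense _ _ tF p h b d).
- move=> s z; have [P0 P1 Poo] := ptE s z.
  rewrite mevFV -!/(pt _ _) P0 P1 Poo /b /d.
  by rewrite !(hornerD, hornerN, hornerZ, hornerX, hornerC); ring.
- move=> s z sc Fs; apply: (DJ (pt s z)) => //; split=> //=.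
  have [_ P1 _] := ptE s z.
  by rewrite /den1 Phi_plus_0 P1 -addrA -opprD subr_eq0.
- by rewrite -X0c -/(pt _ _) -XE.
Qed.

Lemma mev_line (p : {mpoly K[3]}) X (v : 'rV[K]_3) :
  exists q : {poly K}, forall t, q.[t] = mev p (X + t *: v).
Proof.
(* The outer variable does not occur and is set to 0. *)
pose h (i : 'I_3) : {poly {poly K}} := ((X 0 i)%:P + v 0 i *: 'X)%:P.
exists (mmap (polyC \o polyC) h p).[0%:P] => t.
rewrite horner2_mmap; apply: meval_eq => i.
by rewrite !mxE /h !hornerE mulrC.
Qed.

(* F_{X_0} restricts to L as a quadratic polynomial with leading coefficient
   - et * e1, so it vanishes at no more than two points of L. *)
Lemma L0_generic_point (p : {mpoly K[3]}) X : L X -> mev p X != 0 ->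
  exists Y, [/\ L Y, mev p Y != 0 & mev F^`M(vi_0) Y != 0].
Proof.
(* [v] is the direction of the line [L]. *)
move=> [X0 LX] pX; pose v : 'rV[K]_3 := \row_i tnth [tuple 0; et; - e1] i.
have v0 : v 0 vi_0 = 0 by rewrite mxE.
have vt : v 0 vi_t = et by rewrite mxE.
have v1 : v 0 vi_1 = - e1 by rewrite mxE.
have [q qE] := mev_line p X v; have [f fE] := mev_line F^`M(vi_0) X v.
have q0 : q != 0.
  by apply: contra_neq pX => q0; rewrite -[X]addr0 -(scale0r v) -qE q0 horner0.
have f0 : f != 0.
  apply/eqP => f0.
  have fv t : (X 0 vi_t + t * et) * (X 0 vi_1 - t * e1) + X 0 vi_0 *+ 2
      - (a0 * aoo + (et + et^-1) * (e1 + e1^-1)) = 0.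
    rewrite -[RHS](horner0 t) -f0 fE dFVI_0.
    rewrite [(X + _) 0 vi_0]mxE [(X + _) 0 vi_t]mxE [(X + _) 0 vi_1]mxE.
    rewrite [(_ *: v) _ vi_0]mxE [(_ *: v) _ vi_t]mxE [(_ *: v) _ vi_1]mxE.
    by rewrite v0 vt v1; ring.
  have /closed_nonrootP[t] : 'X * ('X - 1%:P) != 0 :> {poly K}.
    by rewrite mulf_neq0 ?polyX_eq0 ?polyXsubC_eq0.
  rewrite rootM rootX root_XsubC negb_or => /andP[t0 t1].
  have /eqP : et * e1 * (t * (t - 1)) = 0.
    pose g s := (X 0 vi_t + s * et) * (X 0 vi_1 - s * e1) + X 0 vi_0 *+ 2
      - (a0 * aoo + (et + et^-1) * (e1 + e1^-1)).
    (* This combination of values at 0, 1 and [t] cancels the constant and linear terms of [g] and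
       isolates its leading coefficient. *)
    transitivity (t * g 1 - g t - (t - 1) * g 0); first by rewrite /g; ring.
    by rewrite /g !fv !mulr0 !subr0.
  rewrite !mulf_eq0 (negbTE et0) (negbTE e10) (negbTE t0) subr_eq0 (negbTE t1).
  by [].
have /closed_nonrootP[t] : q * f != 0 by rewrite mulf_neq0.
rewrite rootM negb_or /root qE fE => /andP[pY fY].
exists (X + t *: v); split=> //; rewrite /L /L0 /=.
rewrite [(X + _) 0 vi_0]mxE [(X + _) 0 vi_t]mxE [(X + _) 0 vi_1]mxE.
rewrite [(_ *: v) _ vi_0]mxE [(_ *: v) _ vi_t]mxE [(_ *: v) _ vi_1]mxE.
by rewrite v0 vt v1 mulr0 addr0; split=> //; rewrite -LX; ring.
Qed.
Lemma L0_not_defined X : L X -> ~ defined_at SVI SV D (Psi a0 et e1 aoo) X.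
Proof.
move=> LX [U [g [[J UE] UX [_ /(_ v_0) gr] gPsi]]].
have [A [B [BX gE]]] := gr X UX.
have [h Jh hX] : exists2 h, J h & mev h X != 0.
  apply: contrapT => nh; have := UX; rewrite UE => -[_ nZ].
  apply: nZ => h Jh.
  by apply/eqP/negPn/negP => hX; apply: nh; exists h.
have [|Y [LY]] := @L0_generic_point (h * B) X LX.
  by rewrite /mev mevalM mulf_neq0.
rewrite /mev mevalM mulf_eq0 negb_or -!/(mev _ _) => /andP[hY BY] fY.
(* If [A / B] extends [- m / d1], then [FVI_factor] divided by [d1] gives [G = 0] on [D] near [X].
   The factors [h] and [B] make this hold on all of [D], hence on [SVI] by density; but at [Y] both
   denominators vanish and only the nonzero term with F_{X_0} remains. *)
pose G : {mpoly K[3]} := A * den2P a0 et e1 aoo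
  + (et * e1) *: (B * (den1P et e1 - F^`M(vi_0))).
have GE Z : mev G Z = mev A Z * den2 a0 et e1 aoo Z
    + et * e1 * (mev B Z * (den1 et e1 Z - mev F^`M(vi_0) Z)).
  rewrite -mev_den1P -mev_den2P /mev mevalD mevalZ !mevalM.
  by rewrite [(den1P _ _ - _).@[_]]mevalB.
have G0 Z : D Z -> mev (h * B * G) Z = 0.
  move=> DZ; have [FZ d1Z] := DZ.
  rewrite {1}/mev !mevalM -!/(mev _ _).
  have [->|hZ] := eqVneq (mev h Z) 0; first by rewrite !mul0r.
  have [->|BZ] := eqVneq (mev B Z) 0; first by rewrite mulr0 mul0r.
  have UZ : U Z by rewrite UE; split=> // /(_ h Jh) /eqP; rewrite (negbTE hZ).
  have [P0 _ _] := PsiE a0 et e1 aoo Z.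
  have AE : mev A Z = Psi_0 a0 et e1 aoo Z * mev B Z.
    by rewrite -P0 -gPsi// gE// divfK.
  have mE : (et * Z 0 vi_t + e1 * Z 0 vi_1 - aoo - et * e1 * a0)
      * den2 a0 et e1 aoo Z =
      et * e1 * (den1 et e1 Z * (den1 et e1 Z - mev F^`M(vi_0) Z)).
    by apply/eqP; rewrite -subr_eq0 -FVI_factor// [mev _ _]FZ mulr0.
  rewrite GE AE.
  suff -> : Psi_0 a0 et e1 aoo Z * mev B Z * den2 a0 et e1 aoo Z =
    - (et * e1 * (mev B Z * (den1 et e1 Z - mev F^`M(vi_0) Z))).
    by rewrite addNr mulr0.
  apply: (mulIf d1Z); rewrite /Psi_0 !mulNr; congr (- _).
  transitivity (mev B Z * ((et * Z 0 vi_t + e1 * Z 0 vi_1 - aoo - et * e1 * a0)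
    * den2 a0 et e1 aoo Z)); last by rewrite mE; ring.
  by field.
have [_ /(_ [set h * B * G])] := zdense_D.
have DJ : D `<=` zero_locus [set h * B * G] by move=> Z DZ _ ->; apply: G0.
move=> /(_ DJ Y (L0_sub et0 e10 LY) _ erefl).
have /(L0P _ _ _ _ _)[d1Y d2Y] := LY.
rewrite {1}/mev !mevalM -!/(mev _ _) GE d1Y d2Y mulr0 add0r sub0r => /eqP.
rewrite !mulf_eq0 oppr_eq0 (negbTE hY) (negbTE BY) (negbTE fY).
by rewrite (negbTE et0) (negbTE e10).
Qed.

End Closed.

(** * The statement over the complex numbers, assembled *)

Unset Implicit Arguments.

Theorem theorem5p2 (R : realType) (a0 aoo et e1 te1 : R[i])
    (Het : et != 0) (He1 : e1 != 0) (Hte1 : te1 = et * e1) :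
  let F : {mpoly R[i][3]} := FVI a0 et e1 aoo in
  let tF : {mpoly R[i][3]} := FV a0 te1 aoo in
  let SVI := hypersurface F in
  let SV := hypersurface tF in
  let q := Phi_plus a0 et e1 aoo in
  let Phi := polymap q in
  let D := SVI `&` [set X | den1 et e1 X != 0] in
  let L := L0 a0 et e1 aoo in
  let dF i X := mev F^`M(i) X in
  let dtF i x := mev tF^`M(i) x in
  (* Phi maps SV to SVI and is birational *)
  (morphism_on SV SVI Phi /\ birational_on SV SVI Phi)
  (* partial derivatives of F along Phi *)
  /\ (forall x, SV x ->
      [/\ dF vi_0 (Phi x) =
            x 0 v_0 / et * (dtF v_0 x / e1 - dtF v_oo x / et)
            - dtF v_1 x / (et * e1) * (x 0 v_1 - et / e1 - e1 / et),
          dF vi_t (Phi x) = dtF v_0 x / e1 - dtF v_oo x / et &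
          dF vi_1 (Phi x) = dtF v_0 x / et + dtF v_oo x / e1
                            - x 0 v_1 * dtF v_oo x / et])
  (* the inverse rational map *)
  /\ (rational_map SVI SV D (Psi a0 et e1 aoo)
      /\ (forall X, D X -> Phi (Psi a0 et e1 aoo X) = X)
      /\ (forall x, SV x -> D (Phi x) -> Psi a0 et e1 aoo (Phi x) = x))
  (* the second expression of its first coordinate, also where the first
     one is not defined *)
  /\ ((forall X, SVI X -> den1 et e1 X != 0 -> den2 a0 et e1 aoo X != 0 ->
         Psi_0 a0 et e1 aoo X = Psi_0' a0 et e1 aoo X)
      /\ (forall x, SV x -> den2 a0 et e1 aoo (Phi x) != 0 ->
            x 0 v_0 = Psi_0' a0 et e1 aoo (Phi x)))
  (* the singular locus of the inverse is the line L *)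
  /\ (L `<=` SVI
      /\ (forall X, SVI X ->
            (L X <-> ~ defined_at SVI SV D (Psi a0 et e1 aoo) X)))
  (* the Fricke polynomials, as an identity of polynomials on C^3 *)
  /\ F \mPo q
     = (- 1 / (et * e1)) *: (('X_v_1 - (et / e1 + e1 / et)%:MP) * tF)
  (* isomorphism onto the complement of L *)
  /\ (isomorphism_on (SV `\` Phi @^-1` L) (SVI `\` L) Phi
      /\ ((forall X, L X -> smooth_at F X) ->
          isomorphism_on SV (SVI `\` L) Phi))
  (* pull-back of the symplectic form; the two forms live on the smooth loci *)
  /\ (forall x, SV x -> smooth_at tF x ->
      (~ L (Phi x) -> smooth_at F (Phi x)) /\
      (smooth_at F (Phi x) ->
       forall u v, tangent_at tF x u -> tangent_at tF x v ->
         pullback q (omegaVI a0 et e1 aoo) x u v = omegaV a0 te1 aoo x u v)).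
Proof.
subst te1 => F tF SVI SV q Phi D L dF dtF.
have subL : L `<=` SVI by exact: L0_sub.
have iso := isomorphism_Phi a0 aoo Het He1.
split; first split; first exact: morphism_Phi.
  (* Birationality is witnessed by the loci [d1 != 0] on both surfaces. *)
  exists (SV `&` [set x | den1 et e1 (Phi x) != 0]), D; split.
  - by split; [exact: zopen_d1_Phi|exact: zdense_D_Phi].
  - by split; [exact: zopen_d1|exact: zdense_D].
  - exact: isomorphism_Phi_d1.
split.
  move=> x tFx; split.
  - exact: dF_Phi_0.
  - exact: dF_Phi_t.
  - exact: dF_Phi_1.
split.
  split; first by split; [exact: zopen_d1|exact: zdense_D|exact: morphism_Psi].
  split=> [X [_ d1X]|x _ [_ d1x]]; first exact: Phi_Psi.
  exact: Psi_Phi.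
split.
  split; first by move=> X FX d1X d2X; exact: Psi_0_Psi_0'.
  by move=> x tFx d2x; exact: Psi_0'_Phi.
split.
  split=> // X FX; split; first exact: L0_not_defined.
  by move=> ndef; apply: contrapT => LX; apply: ndef; exact: defined_at_notL0.
split; first exact: Fricke_Phi_plus.
split.
  split=> // Ls.
  (* If [F] is smooth along [L], no point of [SV] is sent to [L]. *)
  have -> // : SV = SV `\` Phi @^-1` L.
  apply/seteqP; split=> x [] // tFx; split=> // Lx.
  by apply: (L0_Phi_singular Het He1 tFx Lx); exact: Ls.
move=> x tFx tFs; split; first exact: smooth_Phi.
by move=> Fs u v; exact: pullback_omega.
Qed.
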